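(* Let $\tau$ be the strategy with stopping set $B=\bigcup_{k=1}^\infty([b_k,1)\times\{k\})$, where $1>b_1\ge b_2\ge\cdots\ge0$, and let $\sigma=\min\{t:(t,N_t+1)\in B\}$ be its precursor. Then the winning probability with $\tau$ equals $$\mathbb E\,\mathcal S_1(\sigma,N_\sigma)=\sum_{n=1}^\infty\pi_n\sum_{k=0}^{n-1}\mathbb P(N_\sigma=k\mid N=n)\,s_1(k+1,n).$$
   Context: Let $\pi=(\pi_0,\pi_1,\dots)$ be a probability distribution (prior) and let $(p_1,p_2,\dots)$ be a profile of success probabilities with $p_1=1$ and $0<p_k<1$ for $k>1$. Let $N,U_1,U_2,\dots$ be independent with $\mathbb P(N=n)=\pi_n$ and $U_i$ uniform on $[0,1]$. Let $N_t=\sum_{i=1}^{N}1_{\{U_i\le t\}}$, $t\in[0,1]$, and let $T_1<\dots<T_N$ be the ordered values of $U_1,\dots,U_N$ (epochs of the trials). The trial at epoch $T_k$ is a success with probability $p_k$, independently of everything else. The strategy with stopping set $B$ stops at the first success epoch $T_k$ (with index $k$) such that $(T_k,k)\in B$, and does not stop if there is none; it wins if it stops at $T_k$ for some $k$ and no later trial is a success. For $0\le k<n$, $s_1(k+1,n)$ denotes the probability that there is exactly one success among the trials with indices $k+1,\dots,n$ (outcomes independent, trial $j$ being a success with probability $p_j$). $\mathcal S_1(t,k)$ denotes the conditional probability, given $N_t=k$, that there is exactly one success among the trials with indices $k+1,\dots,N$. Terms with $\pi_n=0$ are zero. *)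

(* Defs.v *)
From HB Require Import structures.
From mathcomp Require Import all_boot all_order all_algebra.
From mathcomp Require Import finmap all_classical all_reals all_analysis.

Set Implicit Arguments.
Unset Strict Implicit.
Unset Printing Implicit Defensive.

Import Order.TTheory GRing.Theory Num.Theory.
Import numFieldNormedType.Exports.

Local Open Scope classical_set_scope.
Local Open Scope ring_scope.

Definition cond_prob {d : measure_display} {T : measurableType d}
    {R : realType} (P : probability T R) (A B : set T) : R :=
  fine (P (A `&` B)) / fine (P B).

Definition mutually_independent {d : measure_display} {T : measurableType d}
    {R : realType} (P : probability T R) {I : choiceType}
    (E : I -> set (set T)) : Prop :=
  forall (J : {fset I}) (A : I -> set T),
    (forall i, i \in J -> E i (A i)) ->
    P (\bigcap_(i in [set` J]) A i) = (\prod_(i <- J) P (A i))%E.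

(* Sequences are indexed from 1 (their terms of index 0 play no role):
   U i is the (unordered) time of the i-th point and X k tells whether the k-th
   trial in order of time is a success; X k is given for all k >= 1, but only
   the trials 1, ..., N take place. *)

(* The sigma-algebras generated by N (None), by U 1, U 2, ... (inl)
   and by X 1, X 2, ... (inr). *)
Definition generated_systems {d : measure_display} {T : measurableType d}
    {R : realType} (N : T -> nat) (U : nat -> T -> R) (X : nat -> T -> bool)
    (i : option (nat + nat)) : set (set T) :=
  match i with
  | None => preimage_set_system setT N measurable
  | Some (inl i) => preimage_set_system setT (U i.+1) measurable
  | Some (inr k) => preimage_set_system setT (X k.+1) measurable
  end.

Definition trials_until {T : Type} {R : realType} (N : T -> nat)
    (U : nat -> T -> R) (t : R) (w : T) : nat :=
  (\sum_(1 <= i < (N w).+1) (U i w <= t)%R)%N.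

(* T_k, meaningful for 1 <= k <= N w. *)
Definition epoch {T : Type} {R : realType} (N : T -> nat)
    (U : nat -> T -> R) (k : nat) (w : T) : R :=
  nth 0 (sort <=%R [seq U i w | i <- iota 1 (N w)]) k.-1.

Definition nb_successes {T : Type} (X : nat -> T -> bool) (i n : nat) (w : T)
    : nat :=
  (\sum_(i <= j < n.+1) X j w)%N.

Definition s1 {d : measure_display} {T : measurableType d} {R : realType}
    (P : probability T R) (X : nat -> T -> bool) (i n : nat) : R :=
  fine (P [set w | nb_successes X i n w = 1%N]).

Definition S1 {d : measure_display} {T : measurableType d} {R : realType}
    (P : probability T R) (N : T -> nat) (U : nat -> T -> R)
    (X : nat -> T -> bool) (t : R) (k : nat) : R :=
  cond_prob P [set w | nb_successes X k.+1 (N w) w = 1%N]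
              [set w | trials_until N U t w = k].

Definition stops_at {T : Type} {R : realType} (N : T -> nat)
    (U : nat -> T -> R) (X : nat -> T -> bool) (B : set (R * nat))
    (k : nat) (w : T) : Prop :=
  [/\ (1 <= k <= N w)%N, X k w, B (epoch N U k w, k) &
      forall j, (1 <= j < k)%N -> X j w -> ~ B (epoch N U j w, j)].

Definition wins {T : Type} {R : realType} (N : T -> nat)
    (U : nat -> T -> R) (X : nat -> T -> bool) (B : set (R * nat)) : set T :=
  [set w | exists2 k, stops_at N U X B k w &
           forall j, (k < j <= N w)%N -> ~~ X j w].

(* 0 if A has no minimum. *)
Definition set_min {R : realType} (A : set R) : R := xget 0 (A `&` lbound A).

(* For B = cutoff_set b with 1 > b 1 >= b 2 >= ... >= 0 this minimum exists for every w, as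
   t |-> trials_until N U t w is nondecreasing and right-continuous. *)
Definition precursor {T : Type} {R : realType} (N : T -> nat)
    (U : nat -> T -> R) (B : set (R * nat)) (w : T) : R :=
  set_min [set t | B (t, (trials_until N U t w).+1)].

Definition cutoff_set {R : realType} (b : nat -> R) : set (R * nat) :=
  \bigcup_(k in [set k | (1 <= k)%N]) (`[b k, 1[ `*` [set k]).

(* Main.v *)
Require Import Defs.
From HB Require Import structures.
From mathcomp Require Import all_boot all_order all_algebra.
From mathcomp Require Import finmap all_classical all_reals all_analysis.
From mathcomp Require Import measurable_realfun.

Import Order.TTheory GRing.Theory Num.Theory.
Import numFieldNormedType.Exports.

Local Open Scope classical_set_scope.
Local Open Scope ring_scope.

(** The proof rests on two facts about the precursor sigma and its index
    N_sigma.

    On almost every path, stopping at the k-th trial is allowed exactly when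
    k > N_sigma ([cutoff_epochE]). So the strategy stops at the first success
    among the trials N_sigma + 1, ..., N, and it wins exactly when there is only
    one success among them ([winsE]). Since (N, sigma) is a function of N and of
    the times, which are independent of the outcomes, splitting this event
    according to the values of N and N_sigma gives the double sum
    ([probability_one_success_after_precursor]).

    For the expectation one has to see that conditioning at the random time
    sigma is like conditioning at a fixed time: writing F for the event of
    exactly one success after the trial k,
      E [S1 (sigma, k); N_sigma = k] = P (F, N_sigma = k)
    ([expectation_S1_index]). The event N_sigma = k splits in two. Either
    N_t = k for t = b k.+1, and then sigma is this constant, so that the claim is
    the definition of S1. Or sigma is the k-th epoch and lies in ]b k.+1, b k];
    then sigma = U i for some i <= N which has rank k among the points. For each
    i, the time U i is independent of N, of the other times and of the outcomes,
    so its value can be frozen at t ([integral_at_rank]) and both sides become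
    integrals over t, against the law of one point, of sums over i of
    probabilities that i <= N and that k - 1 of the other points are before t.
    Multiplied by the probability that one point is before t, such a sum counts
    the points before t on the event N_t = k, and so equals k P (N_t = k), or
    k P (F, N_t = k) in presence of F ([sum_at_rank]). The two integrands then
    agree by the definition of S1 ([S1_at_rank]). *)

(** * Order statistics and the precursor, path by path *)

Section paths.
Context {T : Type} {R : realType}.
Variables (N : T -> nat) (U : nat -> T -> R).
Implicit Types (t : R) (k i : nat) (w : T).

Lemma trials_until_count t w :
  trials_until N U t w = count (<= t) [seq U i w | i <- iota 1 (N w)].
Proof.
by rewrite /trials_until /index_iota subSS subn0 count_map -sum1_count [RHS]big_mkcond.
Qed.

Lemma trials_until_homo w :
  {homo (fun t => trials_until N U t w) : s t / s <= t >-> (s <= t)%N}.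
Proof.
move=> s t st; apply: leq_sum => i _.
by case: (leP (U i w) s) => // /le_trans->.
Qed.

Lemma trials_until_le t w : (trials_until N U t w <= N w)%N.
Proof. by rewrite trials_until_count (leq_trans (count_size _ _))// size_map size_iota. Qed.

Definition other_trials_until i t w : nat :=
  (\sum_(1 <= j < (N w).+1 | j != i) (U j w <= t)%R)%N.

Lemma trials_untilD1 i t w : (1 <= i <= N w)%N ->
  trials_until N U t w = ((U i w <= t)%R + other_trials_until i t w)%N.
Proof.
move=> iN; rewrite /trials_until (bigD1_seq i) ?iota_uniq//=.
by rewrite mem_index_iota ltnS.
Qed.

Lemma trials_until_lt i t w : (1 <= i <= N w)%N -> t < U i w ->
  (trials_until N U t w < trials_until N U (U i w) w)%N.
Proof.
move=> iN tU; rewrite !(trials_untilD1 i)// lexx leNgt tU /= add0n ltnS.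
apply: leq_sum => j _.
by case: (leP (U j w) t) => // /le_trans->//; exact: ltW.
Qed.

Let size_epochs w : size (sort <=%R [seq U i w | i <- iota 1 (N w)]) = N w.
Proof. by rewrite size_sort size_map size_iota. Qed.

Lemma epoch_le k w t : (1 <= k <= N w)%N ->
  (epoch N U k w <= t) = (k <= trials_until N U t w)%N.
Proof.
case: k => // k /= kN; rewrite trials_until_count /epoch /=.
set s := map _ _.
have -> : count (<= t) s = count (<= t) (sort <=%R s).
  by apply/permP; rewrite perm_sym perm_sort.
have ss : sorted <=%O (sort <=%R s) by exact: sort_le_sorted.
have [kt|tk] := ltnP k; first exact: nth_count_le.
by apply/negbTE; rewrite -ltNge nth_count_gt// tk size_epochs.
Qed.

Lemma epoch_mem k w : (1 <= k <= N w)%N ->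
  exists2 i, (1 <= i <= N w)%N & epoch N U k w = U i w.
Proof.
case: k => // k /= kN.
have /(mem_nth 0) : (k < size (sort <=%R [seq U i w | i <- iota 1 (N w)]))%N by rewrite size_epochs.
rewrite mem_sort => /mapP[i]; rewrite mem_iota add1n ltnS => ? ?.
by exists i.
Qed.

Lemma epoch_lt k w : uniq [seq U i w | i <- iota 1 (N w)] ->
  (1 <= k)%N -> (k < N w)%N -> epoch N U k w < epoch N U k.+1 w.
Proof.
case: k => // k Uu _ kN; rewrite /epoch /=.
have : sorted <%O (sort <=%R [seq U i w | i <- iota 1 (N w)]).
  by rewrite lt_sorted_uniq_le sort_uniq Uu sort_le_sorted.
move=> /(sorted_ltn_nth lt_trans 0); apply; rewrite ?inE ?size_epochs//.
exact: ltnW.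
Qed.

Variable b : nat -> R.
Hypothesis b1_lt1 : b 1%N < 1.
Hypothesis b_noninc : forall k, (1 <= k)%N -> b k.+1 <= b k.
Local Notation B := (cutoff_set b).
Local Notation sigma := (precursor N U B).
Local Notation Nt := (trials_until N U).

Lemma cutoff_setE t k : (1 <= k)%N -> B (t, k) <-> b k <= t < 1.
Proof.
move=> k1; rewrite /cutoff_set; split.
  by move=> [j /= j1 [/= + kj]]; rewrite kj in_itv.
by move=> bt; exists k => //; split => //=; rewrite in_itv.
Qed.

Lemma cutoff_homo j k : (1 <= j)%N -> (j <= k)%N -> b k <= b j.
Proof.
move=> j1; elim: k => [|k IH]; first by case: j j1.
rewrite leq_eqVlt => /predU1P[<-//|]; rewrite ltnS => jk.
by rewrite (le_trans _ (IH jk))// b_noninc// (leq_trans j1).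
Qed.

(** The times at which stopping at the next trial would be allowed are those
    of [c, 1[, where c is the least of the finitely many numbers b 1 and
    max (b k.+1, T_k); this is why the minimum is attained. *)
Lemma precursor_is_min w :
  ([set t | B (t, (Nt t w).+1)] `&` lbound [set t | B (t, (Nt t w).+1)]) (sigma w).
Proof.
rewrite /precursor /set_min.
set A := [set t | _].
pose c k := if k is 0 then b 1%N else Num.max (b k.+1) (epoch N U k w).
have AE t : A t <-> t < 1 /\ exists2 k, (k <= N w)%N & c k <= t.
  rewrite /A /= cutoff_setE//; split.
    move=> /andP[bt t1]; split=> //; exists (Nt t w); first exact: trials_until_le.
    case E : (Nt t w) => [|k] /=; first by rewrite E in bt.
    by rewrite ge_max -E bt epoch_le ?leqnn// trials_until_le andbT E.
  move=> [t1 [[|k] kN /= ckt]]; rewrite t1 andbT.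
    by rewrite (le_trans _ ckt)// cutoff_homo.
  move: ckt; rewrite ge_max epoch_le// => /andP[bt kt].
  by rewrite (le_trans _ bt)// cutoff_homo.
have [i0 _ i0min] := arg_minP (fun i : 'I_(N w).+1 => c i)
  (erefl : xpredT (ord0 : 'I_(N w).+1)).
have Am : A (c i0).
  apply/AE; split; first by rewrite (le_lt_trans (i0min ord0 isT)).
  by exists i0; rewrite // -ltnS.
have Am' : (A `&` lbound A) (c i0).
  split=> // t /AE[_ [k kN ckt]].
  by rewrite (le_trans _ ckt)// (i0min (Ordinal (kN : (k < (N w).+1)%N))).
by apply: (xgetPex 0); exists (c i0).
Qed.

Lemma precursor_ge w : b (Nt (sigma w) w).+1 <= sigma w.
Proof. by have [/cutoff_setE-/(_ isT)/andP[]] := precursor_is_min w. Qed.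

Lemma precursor_lt1 w : sigma w < 1.
Proof. by have [/cutoff_setE-/(_ isT)/andP[]] := precursor_is_min w. Qed.

Lemma precursor_le t k w : (k <= Nt t w)%N -> b k.+1 <= t -> t < 1 -> sigma w <= t.
Proof.
move=> kt bt t1; have [_ +] := precursor_is_min w; apply.
apply/cutoff_setE => //; rewrite t1 andbT (le_trans _ bt)//.
exact: cutoff_homo.
Qed.

Lemma precursor_leE t w : t < 1 -> (sigma w <= t) = (b (Nt t w).+1 <= t).
Proof.
move=> t1; apply/idP/idP => [st|bt]; last exact: precursor_le bt t1.
rewrite (le_trans _ st)// (le_trans _ (precursor_ge w))// cutoff_homo// ltnS.
exact: trials_until_homo.
Qed.

(** Just before the k-th epoch, namely from the maximum of b k and of the
    preceding epoch on, stopping at the next trial is already allowed. *)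
Lemma precursor_lt_epoch k w : uniq [seq U i w | i <- iota 1 (N w)] ->
  (1 <= k <= N w)%N -> b k < epoch N U k w -> epoch N U k w <= 1 ->
  sigma w < epoch N U k w.
Proof.
move=> Uu; case: k => // -[_ b1T T1|k /= kN bT T1].
  exact: le_lt_trans (@precursor_le (b 1%N) 0 w _ _ _) b1T.
have T_lt : epoch N U k.+1 w < epoch N U k.+2 w by exact: epoch_lt.
have m_lt : Num.max (b k.+2) (epoch N U k.+1 w) < epoch N U k.+2 w.
  by rewrite gt_max bT T_lt.
apply: le_lt_trans m_lt; apply: (@precursor_le _ k.+1).
- by rewrite -epoch_le ?le_max ?lexx ?orbT//= ltnW.
- by rewrite le_max lexx.
- by rewrite (lt_le_trans _ T1)// gt_max bT T_lt.
Qed.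

(** A trial may be stopped at if and only if it comes after the precursor; the
    boundary cases (ties, or an epoch equal to a cutoff or to 1) are excluded
    because the equivalence may fail there. *)
Lemma cutoff_epochE k w : uniq [seq U i w | i <- iota 1 (N w)] ->
  (forall i j, (1 <= i)%N -> (1 <= j)%N -> U i w != b j) ->
  (forall i, (1 <= i)%N -> U i w < 1) ->
  (1 <= k <= N w)%N ->
  B (epoch N U k w, k) <-> (Nt (sigma w) w < k)%N.
Proof.
move=> Uu Ub U1 kN; have /andP[k1 _] := kN.
have [i /andP[i1 _] Ti] := epoch_mem _ _ kN.
have T1 : epoch N U k w < 1 by rewrite Ti U1.
rewrite cutoff_setE// T1 andbT ltnNge -epoch_le// -ltNge; split => [bT|sT].
  apply: precursor_lt_epoch => //; last exact: ltW.
  by rewrite lt_neqAle bT Ti eq_sym Ub.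
rewrite (le_trans _ (ltW sT))// (le_trans _ (precursor_ge w))// cutoff_homo//.
by rewrite ltnNge -epoch_le// -ltNge.
Qed.

(** Before b k.+1 the index is at most k, so the cutoff in force is at least
    b k.+1 and has not been reached. *)
Lemma precursor_cutoff k w : Nt (b k.+1) w = k -> sigma w = b k.+1.
Proof.
move=> Nk; have b1 : b k.+1 < 1 by rewrite (le_lt_trans _ b1_lt1)// cutoff_homo.
apply/eqP; rewrite eq_le precursor_leE// Nk lexx/=.
rewrite leNgt; apply/negP => sb.
have := precursor_ge w; rewrite leNgt => /negP; apply.
rewrite (lt_le_trans sb)// cutoff_homo// ltnS -[leqRHS]Nk.
by apply: trials_until_homo; exact: ltW.
Qed.

(** A point of rank k in the window of index k is the precursor: before it the
    index is less than k, so the cutoff in force is at least b k. *)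
Lemma precursor_point k i w : (1 <= k)%N -> (1 <= i <= N w)%N ->
  b k.+1 < U i w <= b k -> Nt (U i w) w = k -> sigma w = U i w.
Proof.
move=> k1 iN /andP[bU Ub] Nk.
have U1 : U i w < 1 by rewrite (le_lt_trans Ub)// (le_lt_trans _ b1_lt1)// cutoff_homo.
apply/eqP; rewrite eq_le precursor_leE// Nk (ltW bU)/=.
rewrite leNgt; apply/negP => sU.
have := precursor_ge w; rewrite leNgt => /negP; apply.
rewrite (lt_le_trans sU)// (le_trans Ub)// cutoff_homo//.
by rewrite -[leqRHS]Nk; exact: trials_until_lt.
Qed.

(** Once the cutoff b k.+1 is passed, stopping is allowed as soon as the index
    reaches k; so a precursor of index k beyond that cutoff is the k-th epoch. *)
Lemma precursor_epoch k w : uniq [seq U i w | i <- iota 1 (N w)] ->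
  Nt (sigma w) w = k -> b k.+1 < sigma w ->
  (1 <= k)%N /\ exists2 i, (1 <= i <= N w)%N &
    [/\ sigma w = U i w, b k.+1 < U i w <= b k & Nt (U i w) w = k].
Proof.
move=> Uu Nk bs; have s1 := precursor_lt1 w.
have k1 : (1 <= k)%N.
  case: k Nk bs => // Nk bs.
  have := @precursor_le (b 1%N) 0 w isT (lexx _) b1_lt1.
  by rewrite leNgt bs.
have kN : (1 <= k <= N w)%N by rewrite k1 -Nk trials_until_le.
have Ts : epoch N U k w <= sigma w by rewrite epoch_le// Nk.
have sT : sigma w = epoch N U k w.
  apply/eqP; rewrite eq_le Ts andbT leNgt; apply/negP => T_lt.
  have m_lt : Num.max (b k.+1) (epoch N U k w) < sigma w by rewrite gt_max bs.
  suff : sigma w <= Num.max (b k.+1) (epoch N U k w) by rewrite leNgt m_lt.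
  apply: (@precursor_le _ k); rewrite ?(lt_trans m_lt)// ?le_max ?lexx//.
  by rewrite -epoch_le// le_max lexx orbT.
have [i iN Ti] := epoch_mem _ _ kN.
split=> //; exists i => //; rewrite -Ti -sT bs Nk; split => //=.
rewrite leNgt; apply/negP => bks; have : sigma w < epoch N U k w.
  by apply: precursor_lt_epoch; rewrite // -sT // ltW.
by rewrite sT ltxx.
Qed.

End paths.

(** * Winning as a single success *)

Section successes.
Context {T : Type} {R : realType}.
Variables (N : T -> nat) (U : nat -> T -> R) (X : nat -> T -> bool).

Lemma nb_successes1P i n w : nb_successes X i n w = 1%N <->
  exists2 k, (i <= k <= n)%N && X k w &
    forall j, (i <= j <= n)%N -> X j w -> j = k.
Proof.
have mem_in k : (k \in index_iota i n.+1) = (i <= k <= n)%N.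
  by rewrite mem_index_iota ltnS.
split=> [X1|[k /andP[kn Xk] kP]].
- have [k /andP[kn Xk]] : exists k, (i <= k <= n)%N && X k w.
    apply: contrapT => noX; move: X1; rewrite /nb_successes big_seq big1//.
    move=> k; rewrite mem_in => kn; apply/eqP; rewrite eqb0.
    by apply/negP => Xk; apply: noX; exists k; rewrite kn.
  exists k; rewrite ?kn// => j jn Xj; apply/eqP/negPn/negP => jk.
  move: X1; rewrite /nb_successes (bigD1_seq k) ?iota_uniq ?mem_in//= Xk.
  by rewrite -big_filter (bigD1_seq j) ?filter_uniq ?iota_uniq ?mem_filter ?jk ?mem_in//= Xj.
- rewrite /nb_successes (bigD1_seq k) ?iota_uniq ?mem_in//= Xk.
  rewrite big_seq_cond big1// => j /andP[]; rewrite mem_in => jn jk.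
  by apply/eqP; rewrite eqb0; apply: contraNN jk => /(kP _ jn)/eqP.
Qed.

(** If exactly the trials after the m-th are admitted by B, a success that is
    stopped at and not followed by another one is the only one after m. *)
Lemma winsE (B : set (R * nat)) m w :
  (forall k, (1 <= k <= N w)%N -> B (epoch N U k w, k) <-> (m < k)%N) ->
  wins N U X B w <-> nb_successes X m.+1 (N w) w = 1%N.
Proof.
move=> BE; rewrite nb_successes1P; split.
- move=> [k [kN Xk Bk kfirst] klast].
  move: (Bk) => /BE -/(_ kN) mk; exists k; first by rewrite mk Xk; case/andP: kN => _ ->.
  move=> j /andP[mj jN] Xj; apply/eqP; rewrite eqn_leq; apply/andP; split.
    by rewrite leqNgt; apply/negP => kj; move: (klast j); rewrite kj jN Xj => /(_ isT).
  rewrite leqNgt; apply/negP => jk; have j1 : (1 <= j)%N by exact: leq_trans mj.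
  apply: (kfirst j) => //; first by rewrite j1.
  by apply/BE; rewrite ?j1.
- move=> [k /andP[/andP[mk kN] Xk] kP]; have k1 : (1 <= k)%N by exact: leq_trans mk.
  exists k.
    split => //; [by rewrite k1|by apply/BE; rewrite ?k1|].
    move=> j /andP[j1 jk] Xj /BE; rewrite j1 (leq_trans (ltnW jk) kN) => /(_ isT) mj.
    by move: (jk); rewrite -(kP j) ?ltnn// mj (leq_trans (ltnW jk)).
  move=> j /andP[kj jN]; apply/negP => Xj; move: (kj); rewrite -(kP j) ?ltnn// jN andbT.
  exact: ltn_trans kj.
Qed.

End successes.

(** * Independence of generated sigma-algebras *)

Section independence.
Context {d} {T : measurableType d} {R : realType} (P : probability T R).
Context {I : choiceType} (E : I -> set (set T)).
Hypothesis E_measurable : forall i, E i `<=` measurable.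
Hypothesis E_setT : forall i, E i setT.
Hypothesis E_setI : forall i, setI_closed (E i).
Hypothesis E_indep : mutually_independent P E.

(** A pi-system that generates the sigma-algebra of the systems with index in
    K. *)
Definition cylinders (K : set I) : set (set T) :=
  [set A | exists J : {fset I}, exists2 C : I -> set T,
     (forall i, i \in J -> K i /\ E i (C i)) & A = \bigcap_(i in [set` J]) C i].

Lemma sub_cylinders (K : set I) i : K i -> E i `<=` cylinders K.
Proof.
move=> Ki A EA; exists [fset i]%fset; exists (fun=> A).
  by move=> j; rewrite inE => /eqP->.
apply/seteqP; split=> [x Ax j //|x]; apply; exact: fset11.
Qed.

Lemma cylinders_measurable K : cylinders K `<=` measurable.
Proof.
move=> _ [J [C JC ->]]; apply: fin_bigcap_measurable => // i /= /JC[_].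
exact: E_measurable.
Qed.

Lemma cylinders_setT K : cylinders K setT.
Proof.
exists fset0; exists (fun=> setT) => //.
by apply/seteqP; split.
Qed.

Lemma cylinders_setI K : setI_closed (cylinders K).
Proof.
move=> _ _ [J1 [C1 JC1 ->]] [J2 [C2 JC2 ->]].
exists (J1 `|` J2)%fset.
exists (fun i => (if i \in J1 then C1 i else setT) `&`
                 (if i \in J2 then C2 i else setT)).
  move=> i; rewrite inE => /orP J12; split.
    by case: J12 => [/JC1[]|/JC2[]].
  by apply: E_setI; case: ifPn => // iJ; [case: (JC1 i iJ)|case: (JC2 i iJ)].
apply/seteqP; split=> [x [x1 x2] i /= _|x xJ].
  by split; case: ifPn => // iJ; [exact: x1|exact: x2].
by split=> i /= iJ; have := xJ i; rewrite /= inE iJ ?orbT => /(_ isT)[].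
Qed.

Lemma cylinders_indep K1 K2 A B : K1 `&` K2 = set0 ->
  cylinders K1 A -> cylinders K2 B -> P (A `&` B) = (P A * P B)%E.
Proof.
move=> K12 [J1 [C1 JC1 ->]] [J2 [C2 JC2 ->]].
have J12 i : i \in J1 -> i \in J2 -> False.
  by move=> /JC1[k1 _] /JC2[k2 _]; suff : set0 i by []; rewrite -K12.
pose C i := if i \in J1 then C1 i else C2 i.
have CJ1 i : i \in J1 -> C i = C1 i by rewrite /C => ->.
have CJ2 i : i \in J2 -> C i = C2 i.
  by rewrite /C => iJ; case: ifPn => // /J12 /(_ iJ).
have -> : \bigcap_(i in [set` J1]) C1 i `&` \bigcap_(i in [set` J2]) C2 i =
    \bigcap_(i in [set` (J1 `|` J2)%fset]) C i.
  apply/seteqP; split=> [x [x1 x2] i /=|x xJ].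
    by rewrite inE => /orP[iJ|iJ]; rewrite ?(CJ1 _ iJ) ?(CJ2 _ iJ); [exact: x1|exact: x2].
  split=> i /= iJ; rewrite -?(CJ1 _ iJ) -?(CJ2 _ iJ); apply: xJ;
  by rewrite /= inE iJ ?orbT.
rewrite !E_indep; last first.
- move=> i; rewrite inE => /orP[iJ|iJ]; rewrite ?(CJ1 _ iJ) ?(CJ2 _ iJ).
    by case: (JC1 i iJ).
  by case: (JC2 i iJ).
- by move=> i /JC1[].
- by move=> i /JC2[].
have /(perm_big _)-> /= : perm_eq (J1 `|` J2)%fset (J1 ++ J2).
  apply: uniq_perm; rewrite ?fset_uniq//.
    rewrite cat_uniq !fset_uniq andbT /=; apply/hasPn => i iJ2; apply/negP => iJ1.
    exact: J12 iJ1 iJ2.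
  by move=> i; rewrite inE mem_cat.
rewrite big_cat/=; congr (_ * _)%E; rewrite big_seq [RHS]big_seq.
- by apply: eq_bigr => i /CJ1->.
- by apply: eq_bigr => i /CJ2->.
Qed.

Lemma sigma_cylinders_measurable K : <<s cylinders K >> `<=` measurable.
Proof.
by apply: smallest_sub; [exact: sigma_algebra_measurable|exact: cylinders_measurable].
Qed.

Let indep_step (G : set (set T)) B : G `<=` measurable -> setI_closed G -> G setT ->
  measurable B -> (forall A, G A -> P (A `&` B) = (P A * P B)%E) ->
  forall A, <<s G >> A -> P (A `&` B) = (P A * P B)%E.
Proof.
move=> mG GI GT mB GB A sA.
have PB : P B = (fine (P B))%:E by rewrite fineK// fin_num_measure.
have PB0 : (0 <= fine (P B))%R by rewrite fine_ge0.
have mscaleE C : mscale (NngNum PB0) P C = (P C * P B)%E.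
  by rewrite muleC [in RHS]PB.
rewrite -mscaleE; change (mrestr P mB A = mscale (NngNum PB0) P A).
apply: (@g_sigma_algebra_measure_unique _ R T G mG (fun=> setT) (fun=> GT) _
  (mrestr P mB) (mscale (NngNum PB0) P) GI _ _ A sA).
- by rewrite bigcup_const//; exists 0%N.
- by move=> C GC; transitivity (P C * P B)%E; [exact: GB|rewrite -mscaleE].
- move=> _; change (P (setT `&` B) < +oo)%E.
  by rewrite (le_lt_trans (probability_le1 _ _)) ?ltry//; exact: measurableI.
Qed.

(** Two applications of the uniqueness of measures on pi-systems, one for each
    argument, extend the product rule from the cylinders. *)
Lemma sigma_cylinders_indep K1 K2 A B : K1 `&` K2 = set0 ->
  <<s cylinders K1 >> A -> <<s cylinders K2 >> B -> P (A `&` B) = (P A * P B)%E.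
Proof.
move=> K12 sA sB; rewrite setIC muleC.
apply: (@indep_step (cylinders K2)) sB => [||||C C2].
- exact: cylinders_measurable.
- exact: cylinders_setI.
- exact: cylinders_setT.
- exact: sigma_cylinders_measurable sA.
rewrite setIC muleC.
apply: (@indep_step (cylinders K1)) sA => [||||D D1].
- exact: cylinders_measurable.
- exact: cylinders_setI.
- exact: cylinders_setT.
- exact: cylinders_measurable C2.
- exact: cylinders_indep K12 D1 C2.
Qed.

End independence.

Section freezing.
Context {d} {T : measurableType d} {R : realType} (P : probability T R).
Context {I : choiceType} (E : I -> set (set T)).
Hypothesis E_measurable : forall i, E i `<=` measurable.
Hypothesis E_setT : forall i, E i setT.
Hypothesis E_setI : forall i, setI_closed (E i).
Hypothesis E_indep : mutually_independent P E.

Context {d'} {S : measurableType d'} (V : {mfun T >-> S}).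
Variables (i : I) (K : set I).
Hypothesis V_sub : forall A, measurable A -> E i (V @^-1` A).
Hypothesis iK : ~ K i.
Local Notation TK := (g_sigma_algebraType (cylinders E K)).

Lemma measurable_id_cylinders : measurable_fun setT (id : T -> TK).
Proof.
by move=> _ A mA; rewrite setTI; exact: sigma_cylinders_measurable E_measurable _ _ mA.
Qed.

Let idK : {mfun T >-> TK} := mfun_Sub (mem_set measurable_id_cylinders).

Let measurable_VK : measurable_fun setT (fun w => (V w, w) : S * TK).
Proof. by apply/measurable_fun_pairP; split=> //; exact: measurable_id_cylinders. Qed.

Let VK : {mfun T >-> (S * TK)%type} := mfun_Sub (mem_set measurable_VK).

(** When V is independent of everything that f (s, _) depends on, its value can
    be frozen while the rest is integrated: the law of the pair is a product. *)
Lemma ge0_integral_freeze (f : S * TK -> \bar R) :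
  measurable_fun setT f -> (forall z, (0 <= f z)%E) ->
  (\int[P]_w f (V w, w) = \int[distribution P V]_s \int[P]_w f (s, w))%E.
Proof.
move=> mf f0.
have -> : (\int[P]_w f (V w, w) = \int[distribution P VK]_z f z)%E.
  by rewrite (ge0_integral_distribution VK).
have lawVK A : measurable A ->
    ((distribution P V) \x (distribution P idK))%E A = distribution P VK A.
  move=> mA; apply: product_measure_unique => //= B C mB mC.
  rewrite /distribution /pushforward /=.
  apply: (@sigma_cylinders_indep _ _ _ P _ E _ _ _ E_indep [set i] K) => //.
  - by apply/seteqP; split=> // j [/= ->].
  - by apply: sub_gen_smallest; apply: sub_cylinders (V_sub _ mB).
transitivity (\int[((distribution P V) \x (distribution P idK))%E]_z f z)%E.
  by apply: eq_measure_integral => A mA _; exact/esym/lawVK.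
rewrite fubini_tonelli1//; apply: eq_integral => s _.
rewrite /fubini_F (ge0_integral_distribution idK)//.
exact: measurableT_comp (measurable_pair1 _).
Qed.

End freezing.

(** * Measurability *)

Section measurability.
Context {d} {S : measurableType d} {R : realType}.

Lemma measurable_fun_nat_index {d'} {Y : measurableType d'} (n : S -> nat)
    (g : nat -> S -> Y) : measurable_fun setT n ->
  (forall k, measurable_fun setT (g k)) -> measurable_fun setT (fun s => g (n s) s).
Proof.
move=> mn mg _ B mB; rewrite setTI.
rewrite (_ : _ @^-1` B = \bigcup_k (n @^-1` [set k] `&` g k @^-1` B)).
  apply: bigcupT_measurable => k; apply: measurableI; rewrite -[X in measurable X]setTI.
    exact: mn.
  exact: mg.
apply/seteqP; split=> [s Bs|s [k _ [/= <-]]//].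
by exists (n s).
Qed.

Lemma measurable_pred (f : S -> bool) : measurable_fun setT f -> measurable [set s | f s].
Proof.
move=> mf; rewrite (_ : [set s | f s] = setT `&` f @^-1` [set true]); first exact: mf.
by rewrite setTI preimage_true.
Qed.

Lemma measurable_sum_nat (r : seq nat) (Q : pred nat) (f : nat -> S -> nat) :
  (forall i, i \in r -> Q i -> measurable_fun setT (f i)) ->
  measurable_fun setT (fun s => \sum_(i <- r | Q i) f i s)%N.
Proof.
elim: r => [|i r IH] mf; first by under eq_fun do rewrite big_nil; exact: measurable_cst.
have mr : measurable_fun setT (fun s => \sum_(i <- r | Q i) f i s)%N.
  by apply: IH => j jr; apply: mf; rewrite inE jr orbT.
under eq_fun do rewrite big_cons.
have [Qi|_] := boolP (Q i); last exact: mr.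
apply: measurable_fun_addn => //.
by apply: mf => //; rewrite mem_head.
Qed.

Variable N : S -> nat.
Hypothesis mN : measurable_fun setT N.

Lemma measurable_other_trials_until (U : nat -> S -> R) i (t : S -> R) :
  (forall j, (1 <= j)%N -> j != i -> measurable_fun setT (U j)) ->
  measurable_fun setT t ->
  measurable_fun setT (fun s => other_trials_until N U i (t s) s).
Proof.
move=> mU mt; apply: (@measurable_fun_nat_index _ _ N
  (fun n s => \sum_(1 <= j < n.+1 | j != i) (U j s <= t s)%R)%N) => // n.
apply: measurable_sum_nat => j; rewrite mem_index_iota => /andP[j1 _] ji.
apply: (@measurableT_comp _ _ _ _ _ _ nat_of_bool) => //.
by apply: measurable_fun_ler => //; exact: mU.
Qed.

Lemma measurable_nb_successes (X : nat -> S -> bool) (m : S -> nat) :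
  (forall k, (1 <= k)%N -> measurable_fun setT (X k)) -> measurable_fun setT m ->
  measurable_fun setT (fun s => nb_successes X (m s).+1 (N s) s).
Proof.
move=> mX mm.
apply: (@measurable_fun_nat_index _ _ m (fun k s => nb_successes X k.+1 (N s) s)) => // k.
apply: (@measurable_fun_nat_index _ _ N (fun n s => nb_successes X k.+1 n s)) => // n.
apply: measurable_sum_nat => j; rewrite mem_index_iota => /andP[kj _] _.
apply: (@measurableT_comp _ _ _ _ _ _ nat_of_bool) => //.
by apply: mX; exact: leq_trans kj.
Qed.

Variable U : nat -> S -> R.
Hypothesis mU : forall i, (1 <= i)%N -> measurable_fun setT (U i).

Lemma measurable_trials_until (t : S -> R) : measurable_fun setT t ->
  measurable_fun setT (fun s => trials_until N U (t s) s).
Proof.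
move=> mt; apply: (@measurable_fun_nat_index _ _ N
  (fun n s => \sum_(1 <= j < n.+1) (U j s <= t s)%R)%N) => // n.
apply: measurable_sum_nat => j; rewrite mem_index_iota => /andP[j1 _] _.
apply: (@measurableT_comp _ _ _ _ _ _ nat_of_bool) => //.
by apply: measurable_fun_ler => //; exact: mU.
Qed.

Lemma measurable_fun_gt (f : S -> R) :
  (forall x, measurable [set s | x < f s]) -> measurable_fun setT f.
Proof.
move=> mf; apply: (measurability _ (RGenOInfty.measurableE R)) => //.
move=> _ [_ [x ->] <-]; rewrite setTI (_ : _ @^-1` _ = [set s | x < f s])//.
by apply/seteqP; split=> s /=; rewrite in_itv/= andbT.
Qed.

(** The truncation is there because the number [epoch N U k s] means nothing when
    k > N s. *)
Lemma measurable_epoch k : (1 <= k)%N ->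
  measurable_fun setT (fun s => if (k <= N s)%N then epoch N U k s else 0).
Proof.
move=> k1; apply: measurable_fun_gt => x.
rewrite (_ : [set s | _] = [set s | ((k <= N s)%N && (trials_until N U x s < k)%N)
    || ((N s < k)%N && (x < 0))]).
  apply: measurable_pred; apply: measurable_or; apply: measurable_and => //.
  - exact: measurable_fun_leq.
  - by apply: measurable_fun_ltn => //; exact: measurable_trials_until.
  - exact: measurable_fun_ltn.
apply/seteqP; split=> s /=; have [kN|kN] := leqP k (N s); rewrite /= ?orbF//;
  by rewrite ltNge epoch_le ?k1// -ltnNge.
Qed.

Variable b : nat -> R.
Hypothesis b1_lt1 : b 1%N < 1.
Hypothesis b_noninc : forall k, (1 <= k)%N -> b k.+1 <= b k.
Local Notation B := (cutoff_set b).
Local Notation sigma := (precursor N U B).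

Lemma measurable_precursor : measurable_fun setT sigma.
Proof.
apply: measurable_fun_gt => x; have [x1|x1] := leP 1 x.
  rewrite (_ : [set s | _] = set0)//; apply/seteqP; split=> // s /=.
  by rewrite ltNge (le_trans _ x1)// ltW// precursor_lt1.
rewrite (_ : [set s | _] = [set s | x < b (trials_until N U x s).+1]).
  apply: measurable_pred; apply: measurable_fun_ltr => //.
  apply: (@measurableT_comp _ _ _ _ _ _ (fun k => b k.+1)) => //.
  exact: measurable_trials_until.
by apply/seteqP; split=> s /=; rewrite !ltNge precursor_leE.
Qed.

Lemma measurable_precursor_index :
  measurable_fun setT (fun s => trials_until N U (sigma s) s).
Proof. by apply: measurable_trials_until; exact: measurable_precursor. Qed.

Lemma measurable_wins (X : nat -> S -> bool) :
  (forall k, (1 <= k)%N -> measurable_fun setT (X k)) ->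
  measurable (wins N U X B).
Proof.
move=> mX.
have mB k : (1 <= k)%N -> measurable [set s | (k <= N s)%N /\ B (epoch N U k s, k)].
  move=> k1; pose e s := if (k <= N s)%N then epoch N U k s else 0.
  rewrite (_ : mkset _ = [set s | (k <= N s)%N && ((b k <= e s) && (e s < 1))]).
    have me : measurable_fun setT e by exact: measurable_epoch.
    apply: measurable_pred; apply: measurable_and; first exact: measurable_fun_leq.
    apply: measurable_and; first exact: measurable_fun_ler.
    exact: measurable_fun_ltr.
  apply/seteqP; split=> s /=.
    by rewrite /e => -[-> /cutoff_setE]; apply.
  by rewrite /e => /andP[kN]; rewrite kN => bs; split=> //; apply/cutoff_setE.
rewrite (_ : wins N U X B = \bigcup_(k in [set k | (1 <= k)%N])
    ([set s | (k <= N s)%N /\ B (epoch N U k s, k)] `&` [set s | X k s] `&`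
     \bigcap_(j in [set j | (1 <= j < k)%N])
       ~` ([set s | X j s] `&` [set s | (j <= N s)%N /\ B (epoch N U j s, j)]) `&`
     \bigcap_(j in [set j | (k < j)%N]) ~` [set s | (j <= N s)%N && X j s])).
  apply: bigcup_measurable => k /= k1.
  apply: measurableI; first apply: measurableI; first apply: measurableI.
  - exact: mB.
  - by apply: measurable_pred; exact: mX.
  - apply: bigcap_measurableType => j /= /andP[j1 _]; apply: measurableC.
    by apply: measurableI; [apply: measurable_pred; exact: mX|exact: mB].
  - apply: bigcap_measurableType => j /= kj; apply: measurableC.
    apply: measurable_pred; apply: measurable_and; first exact: measurable_fun_leq.
    by apply: mX; exact: leq_trans kj.
apply/seteqP; split=> s.
- move=> [k [/andP[k1 kN] Xk Bk kfirst] klast]; exists k => //; split; first split; first by split.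
    by move=> j /= jk [/= Xj [_]]; exact: kfirst.
  by move=> j /= kj /andP[jN]; apply/negP; apply: klast; rewrite kj.
- move=> [k /= k1 [[[[kN Bk] Xk] kfirst] klast]]; exists k.
    split; [by rewrite k1|by []|by []|move=> j jk Xj Bj].
    apply: (kfirst j jk); split=> //; split=> //=.
    by case/andP: jk => _ /ltnW /leq_trans; apply.
  by move=> j /andP[kj jN]; apply/negP => Xj; apply: (klast j kj); rewrite /= jN.
Qed.

End measurability.

(** * Auxiliary facts on series, null sets and the uniform law *)

Section auxiliary.
Context {R : realType}.

Lemma nneseries_trunc (f : nat -> \bar R) n : (forall i, (0 <= f i)%E) ->
  (forall i, (n <= i)%N -> f i = 0%E) ->
  (\sum_(0 <= i <oo) f i = \sum_(0 <= i < n) f i)%E.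
Proof.
move=> f0 fn; rewrite (nneseries_split 0 n)// add0n [X in (_ + X)%E]eseries0 ?adde0//.
by move=> i ni _; exact: fn.
Qed.

Lemma nneseries_pick (f : nat -> \bar R) n : (forall i, (0 <= f i)%E) ->
  (forall i, i != n -> f i = 0%E) ->
  (\sum_(0 <= i <oo) f i = f n)%E.
Proof.
move=> f0 fn; rewrite (@nneseriesD1 _ _ n)//= eseries0 ?adde0// => i _ /= ni.
exact: fn.
Qed.

Lemma ae_eq_probability {d} {T : measurableType d} (P : probability T R) (A B : set T) :
  measurable A -> measurable B -> {ae P, forall w, A w <-> B w} -> P A = P B.
Proof.
move=> mA mB AB; rewrite -[A]setIT -[B]setIT -!integral_indic//.
apply: ge0_ae_eq_integral => //.
- exact/measurable_EFinP/measurable_indic.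
- exact/measurable_EFinP/measurable_indic.
- apply: filterS AB => w AB _; congr (_%:E); rewrite !indicE; congr (_%:R).
  by congr nat_of_bool; apply/idP/idP; rewrite !inE => /AB.
Qed.

Local Notation unif := (uniform_prob (@ltr01 R)).

Lemma uniform_prob_set1 (x : R) : unif [set x] = 0%E.
Proof. exact: (@integral_Sset1 _ _ _ x). Qed.

Lemma uniform_prob_ge1 : unif `[1, +oo[ = 0%E.
Proof.
rewrite /uniform_prob integral_uniform_pdf; apply: (@integral_Sset1 _ _ _ 1) => x /=.
by rewrite !in_itv/= andbT => -[x1 /andP[_ x1']]; apply/eqP; rewrite eq_le x1 x1'.
Qed.

Lemma uniform_prob_gt0 (t : R) : 0 < t -> (0 < unif `]-oo, t])%E.
Proof.
move=> t0; have m0 : 0 < Num.min t 1 by rewrite lt_min t0 ltr01.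
apply: (@lt_le_trans _ _ (unif `[0, Num.min t 1])); last first.
  apply: le_measure; rewrite ?inE//= => x /=.
  by rewrite !in_itv/= => /andP[_]; rewrite le_min => /andP[].
rewrite /uniform_prob (eq_integral (fun=> 1%E)); last first.
  move=> x; rewrite inE/= in_itv/= le_min => /andP[x0 /andP[_ x1]].
  by rewrite /uniform_pdf x0 x1/= subr0 invr1.
by rewrite integral_cst//= mul1e lebesgue_measure_itv/= lte_fin m0 oppr0 adde0 lte_fin.
Qed.

End auxiliary.

(** * The model *)

Section model.
Context {R : realType} {d : measure_display} {T : measurableType d}.
Variables (P : probability T R) (b : nat -> R).
Variables (N : {RV P >-> nat}) (U : nat -> {RV P >-> R}) (X : nat -> {RV P >-> bool}).
Hypothesis U_law : forall i, (1 <= i)%N -> forall A : set R, measurable A ->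
  distribution P (U i) A = uniform_prob (@ltr01 R) A.
Hypothesis indep : mutually_independent P (generated_systems N U X).

Local Notation nu := (distribution P (U 1)).
Local Notation E := (generated_systems N U X).
Local Notation Nt := (trials_until N U).

Lemma generated_systems_preimage i : exists (d' : measure_display)
  (Y : measurableType d') (V : {mfun T >-> Y}),
  E i = preimage_set_system setT V measurable.
Proof.
by case: i => [[i|k]|]; [exists _, _, (U i.+1)|exists _, _, (X k.+1)|exists _, _, N].
Qed.

Lemma generated_systems_measurable i : E i `<=` measurable.
Proof.
have [d' [Y [V ->]]] := generated_systems_preimage i.
by move=> _ [A mA <-]; apply: measurable_funP.
Qed.

Lemma generated_systems_setT i : E i setT.
Proof.
have [d' [Y [V ->]]] := generated_systems_preimage i.
by exists setT => //; rewrite preimage_setT setIT.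
Qed.

Lemma generated_systems_setI i : setI_closed (E i).
Proof.
have [d' [Y [V ->]]] := generated_systems_preimage i.
move=> _ _ [A mA <-] [B mB <-]; exists (A `&` B); first exact: measurableI.
by rewrite !setTI preimage_setI.
Qed.

(** Index sets for the systems generated by N, U and X; the point U i has index
   inl i.-1, and the outcome X k has index inr k.-1. *)
Definition times_and_number : set (option (nat + nat)) :=
  [set i | if i is Some (inr _) then False else True].
Definition outcomes : set (option (nat + nat)) :=
  [set i | if i is Some (inr _) then True else False].
Definition all_but_time i : set (option (nat + nat)) := [set~ Some (inl i.-1)].

Local Notation sub K := (g_sigma_algebraType (cylinders E K)).

Lemma measurable_fun_sub {d'} {Y : measurableType d'} (V : T -> Y) K i :
  E i = preimage_set_system setT V measurable -> K i ->
  measurable_fun (setT : set (sub K)) V.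
Proof.
move=> EV Ki _ A mA; apply: sub_gen_smallest.
by apply: (sub_cylinders E _ _ Ki); rewrite EV; exists A.
Qed.

Lemma measurable_number_sub K : K None -> measurable_fun (setT : set (sub K)) N.
Proof. exact: measurable_fun_sub. Qed.

Lemma measurable_time_sub K i : (1 <= i)%N -> K (Some (inl i.-1)) ->
  measurable_fun (setT : set (sub K)) (U i).
Proof. by case: i => // i _; exact: measurable_fun_sub. Qed.

Lemma measurable_outcome_sub K k : (1 <= k)%N -> K (Some (inr k.-1)) ->
  measurable_fun (setT : set (sub K)) (X k).
Proof. by case: k => // k _; exact: measurable_fun_sub. Qed.

Lemma sub_measurable K (A : set T) :
  measurable (A : set (sub K)) -> measurable A.
Proof.
by move=> mA; exact: (sigma_cylinders_measurable _ generated_systems_measurable _ _ mA).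
Qed.

Lemma indep_sub K1 K2 (A B : set T) : K1 `&` K2 = set0 ->
  measurable (A : set (sub K1)) -> measurable (B : set (sub K2)) ->
  P (A `&` B) = (P A * P B)%E.
Proof.
exact: (@sigma_cylinders_indep _ _ _ P _ E generated_systems_measurable
  generated_systems_setT generated_systems_setI indep).
Qed.

(** The law of the first point stands for the common law of all the points. *)
Lemma time_freeze i (f : R * sub (all_but_time i) -> \bar R) : (1 <= i)%N ->
  measurable_fun setT f -> (forall z, (0 <= f z)%E) ->
  (\int[P]_w f (U i w, w) = \int[nu]_t \int[P]_w f (t, w))%E.
Proof.
case: i f => // i f _ mf f0.
rewrite (@ge0_integral_freeze _ _ _ P _ E generated_systems_measurable
  generated_systems_setT generated_systems_setI indep _ _ (U i.+1) (Some (inl i))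
  (all_but_time i.+1))//.
- by apply: eq_measure_integral => A mA _; apply/etrans/esym/U_law => //; exact: U_law.
- by move=> A mA; exists A => //; rewrite setTI.
- by move=> /=; apply.
Qed.

Lemma time_eq_null i x : (1 <= i)%N -> P [set w | U i w = x] = 0%E.
Proof.
move=> i1; rewrite -(uniform_prob_set1 x) -(U_law i i1)//.
Qed.

Lemma time_ge1_null i : (1 <= i)%N -> P [set w | 1 <= U i w] = 0%E.
Proof.
move=> i1; rewrite -(@uniform_prob_ge1 R) -(U_law i i1)//.
rewrite /distribution /pushforward; congr (P _).
by apply/seteqP; split=> w /=; rewrite in_itv/= andbT.
Qed.

(** Freezing U i leaves the event that U j takes a given value, which is null
    for a law without atoms. *)
Lemma ties_null i j : (1 <= i)%N -> (1 <= j)%N -> i != j ->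
  P [set w | U i w = U j w] = 0%E.
Proof.
move=> i1 j1 ij; pose D := [set z : R * sub (all_but_time i) | z.1 == U j z.2].
have mD : measurable D.
  apply: measurable_pred; apply: measurable_fun_eqr; first exact: measurable_fst.
  apply: (measurableT_comp _ measurable_snd); apply: measurable_time_sub => //=.
  by move=> [] /(congr1 S); rewrite !prednK// => /eqP; rewrite eq_sym (negbTE ij).
have mD1 : measurable [set w | U i w == U j w].
  by apply: measurable_pred; exact: measurable_fun_eqr.
have DE : [set w | U i w = U j w] = [set w | U i w == U j w].
  by apply/seteqP; split=> w /= /eqP.
rewrite DE -[X in P X]setIT -integral_indic//.
have := @time_freeze i (fun z => (\1_D z)%:E) i1.
rewrite (_ : (fun w => _) = (fun w => (\1_[set w | U i w == U j w] w)%:E)); last first.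
  by apply/funext => w; rewrite !indicE; congr (_%:R%:E); congr nat_of_bool;
     apply/idP/idP; rewrite !inE.
move=> ->; last 2 first.
- exact/measurable_EFinP/measurable_indic.
- by move=> z; rewrite lee_fin.
apply: integral0_eq => t _ /=.
rewrite (_ : (fun w => _) = (fun w => (\1_[set w | U j w = t] w)%:E)); last first.
  apply/funext => w; rewrite !indicE; congr (_%:R%:E); congr nat_of_bool.
  by apply/idP/idP; rewrite !inE /D/=; [move=> /eqP ->|move=> ->].
rewrite integral_indic//; first by rewrite setIT; exact: time_eq_null.
rewrite (_ : [set w | _] = [set w | U j w == t]).
  by apply: measurable_pred; apply: measurable_fun_eqr.
by apply/seteqP; split=> w /= /eqP.
Qed.

(** The paths without ties, on which moreover no point is a cutoff or comes too
    late to be stopped at. *)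
Definition generic (w : T) : Prop :=
  [/\ uniq [seq U i w | i <- iota 1 (N w)],
      forall i j, (1 <= i)%N -> (1 <= j)%N -> U i w != b j &
      forall i, (1 <= i)%N -> U i w < 1].

Lemma ae_generic : {ae P, forall w, generic w}.
Proof.
have null (A : set T) : measurable A -> P A = 0%E -> {ae P, forall w, ~ A w}.
  by move=> mA A0; exists A; split=> // w /= /contrapT.
have meq (f g : T -> R) : measurable_fun setT f -> measurable_fun setT g ->
    measurable [set w | f w = g w].
  move=> mf mg; rewrite (_ : [set w | _] = [set w | f w == g w]).
    by apply: measurable_pred; exact: measurable_fun_eqr.
  by apply/seteqP; split=> w /= /eqP.
have noties : {ae P, forall w, forall i j, (1 <= i)%N -> (1 <= j)%N -> i != j -> U i w <> U j w}.
  apply: ae_foralln => i; apply: ae_foralln => j.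
  have [i0|i1] := leqP i 0; first by apply: aeW.
  have [j0|j1] := leqP j 0; first by apply: aeW.
  have [->|ij] := eqVneq i j; first exact: aeW.
  apply: filterS (null [set w | U i w = U j w] _ _) => [w + _ _ _//||].
    exact: meq.
  exact: ties_null.
have nob : {ae P, forall w, forall i j, (1 <= i)%N -> (1 <= j)%N -> U i w <> b j}.
  apply: ae_foralln => i; apply: ae_foralln => j.
  have [i0|i1] := leqP i 0; first by apply: aeW.
  apply: filterS (null [set w | U i w = b j] _ _) => [w + _ _//||].
    exact: meq.
  exact: time_eq_null.
have lt1 : {ae P, forall w, forall i, (1 <= i)%N -> ~ (1 <= U i w)}.
  apply: ae_foralln => i.
  have [i0|i1] := leqP i 0; first by apply: aeW.
  apply: filterS (null [set w | 1 <= U i w] _ _) => [w + _//||].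
    by apply: measurable_pred; exact: measurable_fun_ler.
  exact: time_ge1_null.
apply: filterS3 noties nob lt1 => w Hn Hb H1; split.
- rewrite map_inj_in_uniq ?iota_uniq// => i j; rewrite !mem_iota => /andP[i1 _] /andP[j1 _] Uij.
  by apply/eqP/negPn/negP => ij; exact: (Hn i j).
- by move=> i j i1 j1; apply/eqP; exact: Hb.
- by move=> i i1; rewrite ltNge; apply/negP; exact: H1.
Qed.

(** * The posterior at the precursor *)

(** When P B = 0 the quotient is 0 too, so the product rule still holds. *)
Lemma cond_probM (A B : set T) : measurable A -> measurable B ->
  ((cond_prob P A B)%:E * P B = P (A `&` B))%E.
Proof.
move=> mA mB; have mAB : measurable (A `&` B) by exact: measurableI.
rewrite /cond_prob; have [B0|B0] := eqVneq (fine (P B)) 0.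
  have PB0 : P B = 0%E by rewrite -[P B]fineK ?fin_num_measure// B0.
  have : (P (A `&` B) <= P B)%E by apply: le_measure; rewrite ?inE//; exact: subIsetr.
  by rewrite PB0 mule0 => PAB; apply/eqP; rewrite eq_le measure_ge0 PAB.
rewrite -[P B in LHS]fineK ?fin_num_measure// -EFinM divfK//.
by rewrite fineK// fin_num_measure.
Qed.

Lemma cond_prob_ge0 (A B : set T) : 0 <= cond_prob P A B.
Proof. by rewrite /cond_prob divr_ge0// fine_ge0. Qed.

(** Counting only the other points makes the event independent of U i when t is
    fixed, while for t = U i it says that U i is the k-th point. *)
Definition at_rank k i t w :=
  (i <= N w)%N && ((other_trials_until N U i t w).+1 == k).

Lemma measurable_at_rank {d'} {S : measurableType d'} (g : S -> T) k i (t : S -> R) :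
  measurable_fun setT (fun s => N (g s)) ->
  (forall j, (1 <= j)%N -> j != i -> measurable_fun setT (fun s => U j (g s))) ->
  measurable_fun setT t ->
  measurable_fun setT (fun s => at_rank k i (t s) (g s)).
Proof.
move=> mN mU mt; apply: measurable_and; first exact: measurable_fun_leq.
apply: measurable_fun_eqn => //; apply: (@measurableT_comp _ _ _ _ _ _ succn) => //.
exact: (@measurable_other_trials_until _ _ _ _ mN (fun j s => U j (g s)) i t mU mt).
Qed.

Lemma measurable_section_probability (D : set (R * T)) : measurable D ->
  measurable_fun setT (fun t => P [set w | D (t, w)]).
Proof.
move=> mD; rewrite (_ : (fun _ => _) = P \o xsection D); last first.
  apply/funext => t /=; congr (P _).
  by apply/seteqP; split=> w; rewrite /xsection/= inE.
exact: measurable_fun_xsection.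
Qed.

Lemma measurable_at_rank_probability k i (F : set T) : measurable F ->
  measurable_fun setT (fun t => P (F `&` [set w | at_rank k i t w])).
Proof.
move=> mF; apply: (@measurable_section_probability
  [set z | F z.2 /\ at_rank k i z.1 z.2]).
apply: (@measurableI _ _ (snd @^-1` F) [set z | at_rank k i z.1 z.2]).
  by rewrite -[X in measurable X]setTI; exact: measurable_snd.
apply: measurable_pred; apply: (@measurable_at_rank _ _ snd).
- exact: (measurableT_comp _ measurable_snd).
- by move=> j _ _; exact: (measurableT_comp _ measurable_snd).
- exact: measurable_fst.
Qed.

Lemma all_but_timeP i j : (1 <= i)%N -> (1 <= j)%N -> j != i ->
  all_but_time i (Some (inl j.-1)).
Proof.
move=> i1 j1 ji [] /(congr1 S); rewrite !prednK// => /eqP.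
by rewrite (negbTE ji).
Qed.

(** The events to which every single U i is irrelevant. *)
Definition time_free (F : set T) := forall i, (1 <= i)%N ->
  measurable (F : set (sub (all_but_time i))).

Lemma time_free_measurable F : time_free F -> measurable F.
Proof. by move=> /(_ 1 isT); exact: sub_measurable. Qed.

(** U i is independent of F and of the other points, so it can be frozen. *)
Lemma integral_at_rank k i (F : set T) (h : R -> R) : (1 <= i)%N -> time_free F ->
  measurable_fun setT h -> (forall t, 0 <= h t) ->
  (\int[P]_w (h (U i w) * (\1_F w * (at_rank k i (U i w) w)%:R))%:E =
   \int[nu]_t ((h t)%:E * P (F `&` [set w | at_rank k i t w])))%E.
Proof.
move=> i1 tF mh h0; have mF := time_free_measurable _ tF.
rewrite (@time_freeze i
  (fun z => (h z.1 * (\1_F z.2 * (at_rank k i z.1 z.2)%:R))%:E))//; last 2 first.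
- apply/measurable_EFinP; apply: measurable_funM.
    exact: (measurableT_comp mh measurable_fst).
  apply: measurable_funM.
    by apply: (@measurableT_comp _ _ _ _ _ _ (\1_F : sub (all_but_time i) -> R) _ snd) => //;
      apply: measurable_indic; exact: tF.
  apply: (@measurableT_comp _ _ _ _ _ _ (fun c : bool => c%:R : R)) => //.
  apply: (@measurable_at_rank _ _ (snd : R * sub (all_but_time i) -> T)).
  + by apply: (measurableT_comp _ measurable_snd); exact: measurable_number_sub.
  + move=> j j1 ji; apply: (measurableT_comp _ measurable_snd).
    by apply: measurable_time_sub => //; exact: all_but_timeP.
  + exact: measurable_fst.
- by move=> z; rewrite lee_fin !mulr_ge0// ler0n.
apply: eq_integral => t _.
have mr : measurable [set w | at_rank k i t w].
  by apply: measurable_pred; apply: (@measurable_at_rank _ _ id).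
transitivity (\int[P]_w ((h t)%:E * (\1_(F `&` [set w | at_rank k i t w]) w)%:E))%E.
  apply: eq_integral => w _; rewrite -EFinM indicI; congr (_ * (_ * _))%:E.
  by rewrite indicE; congr (nat_of_bool _)%:R; apply/idP/idP; rewrite inE.
rewrite ge0_integralZl//.
- by rewrite integral_indic ?setIT//; exact: measurableI.
- by apply/measurable_EFinP/measurable_indic; exact: measurableI.
- by rewrite lee_fin.
Qed.

(** Multiplied by the probability that one given point lies before t, the
    density of a point of rank k at t becomes the expected number of the points
    before t on the event that there are k of them. *)
Lemma sum_at_rank k (t : R) (F : set T) : time_free F ->
  (nu `]-oo, t] * \sum_(0 <= i <oo) P (F `&` [set w | at_rank k i.+1 t w]) =
   k%:R%:E * P (F `&` [set w | Nt t w = k]))%E.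
Proof.
move=> tF; have mF := time_free_measurable _ tF.
pose Ut i := [set w | U i w <= t].
have mUt i : measurable (Ut i) by apply: measurable_pred; exact: measurable_fun_ler.
have nut i : (1 <= i)%N -> nu `]-oo, t] = P (Ut i).
  by move=> i1; rewrite U_law// -(U_law i i1).
have mr i : measurable [set w | at_rank k i t w].
  by apply: measurable_pred; apply: (@measurable_at_rank _ _ id).
have mNt : measurable [set w | Nt t w = k].
  rewrite (_ : mkset _ = [set w | Nt t w == k]).
    apply: measurable_pred; apply: measurable_fun_eqn => //.
    by apply: measurable_trials_until => //.
  by apply/seteqP; split=> w /= /eqP.
have fin_nu : nu `]-oo, t] \is a fin_num by exact: fin_num_measure.
rewrite -(fineK fin_nu) -nneseriesZl; last by move=> i _; exact: measure_ge0.
rewrite (fineK fin_nu).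
pose f i w : \bar R := (\1_(F `&` [set w | Nt t w = k]) w *
  ((i.+1 <= N w)%N && (U i.+1 w <= t))%:R)%:E.
have mf i : measurable_fun setT (f i).
  apply/measurable_EFinP; apply: measurable_funM.
    by apply: measurable_indic; exact: measurableI.
  apply: (@measurableT_comp _ _ _ _ _ _ (fun c : bool => c%:R : R)) => //.
  by apply: measurable_and; [exact: measurable_fun_leq|exact: measurable_fun_ler].
have f0 i w : (0 <= f i w)%E by rewrite lee_fin mulr_ge0// ler0n.
transitivity (\sum_(0 <= i <oo) \int[P]_w f i w)%E.
  apply: eq_eseriesr => i _; rewrite (nut i.+1)//.
  rewrite -(@indep_sub [set Some (inl i)] (all_but_time i.+1)); first last.
  - apply: measurableI; first exact: tF.
    apply: measurable_pred; apply: (@measurable_at_rank _ (sub (all_but_time i.+1)) id) => //.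
      exact: measurable_number_sub.
    by move=> j j1 ji; apply: measurable_time_sub => //; exact: all_but_timeP.
  - apply: measurable_pred; apply: measurable_fun_ler => //.
    exact: measurable_time_sub.
  - by apply/seteqP; split=> // x [/= ->]; apply.
  have mI : measurable (Ut i.+1 `&` (F `&` [set w | at_rank k i.+1 t w])).
    by apply: measurableI => //; exact: measurableI.
  rewrite -[X in P X]setIT -integral_indic//; apply: eq_integral => w _; congr (_%:E).
  rewrite !indicI /= !indicE mulrCA -mulrA; congr (_ * _).
  rewrite -natrM mulnb -natrM mulnb; congr (nat_of_bool _)%:R.
  apply/idP/idP => /andP[]; rewrite !inE /Ut /at_rank /=.
    move=> Ui /andP[iN /eqP rk]; rewrite iN Ui !andbT inE /=.
    by rewrite (@trials_untilD1 _ _ _ _ i.+1)// Ui add1n.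
  move=> Nk /andP[iN Ui]; apply/andP; split; first by rewrite inE.
  by rewrite inE /= iN -Nk (@trials_untilD1 _ _ _ _ i.+1)// Ui add1n /=.
rewrite -integral_nneseries//.
transitivity (\int[P]_w (k%:R%:E * (\1_(F `&` [set w | Nt t w = k]) w)%:E))%E; last first.
  have mI : measurable (F `&` [set w | Nt t w = k]) by exact: measurableI.
  rewrite ge0_integralZl//.
  - by rewrite integral_indic ?setIT.
  - exact/measurable_EFinP/measurable_indic.
apply: eq_integral => w _.
rewrite (@nneseries_trunc _ _ (N w))//; last first.
  by move=> i; rewrite leqNgt /f => /negbTE->; rewrite mulr0.
rewrite sumEFin -EFinM -mulr_sumr mulrC; congr (_%:E).
rewrite indicE; have [|] := boolP (w \in _); last by rewrite !mulr0.
rewrite inE => -[_ /= Nk]; rewrite !mulr1 -natr_sum; congr (_%:R).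
rewrite -Nk /trials_until big_add1 /= [LHS]big_nat [RHS]big_nat.
by apply: eq_bigr => i /andP[_ ->].
Qed.

Hypothesis b1_lt1 : b 1%N < 1.
Hypothesis b_noninc : forall k, (1 <= k)%N -> b k.+1 <= b k.
Hypothesis b_ge0 : forall k, (1 <= k)%N -> 0 <= b k.
Local Notation B := (cutoff_set b).
Local Notation sigma := (precursor N U B).
Local Notation Nsigma := (fun w => Nt (sigma w) w).

(** The precursor has index k without being the cutoff b k.+1: it is then the
    k-th epoch. *)
Definition jumps_at k : set T := [set w | Nsigma w = k /\ b k.+1 < sigma w].

Lemma measurable_sigma : measurable_fun setT sigma.
Proof. exact: measurable_precursor. Qed.

Lemma measurable_Nsigma_eq k : measurable [set w | Nsigma w = k].
Proof.
rewrite (_ : mkset _ = [set w | Nsigma w == k]).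
  apply: measurable_pred; apply: measurable_fun_eqn => //.
  exact: measurable_precursor_index.
by apply/seteqP; split=> w /= /eqP.
Qed.

Lemma measurable_jumps_at k : measurable (jumps_at k).
Proof.
apply: (measurableI _ _ (measurable_Nsigma_eq k)).
by apply: measurable_pred; apply: measurable_fun_ltr => //; exact: measurable_sigma.
Qed.

Lemma jumps_atP k i w : (1 <= i)%N ->
  (b k.+1 < U i w <= b k) && at_rank k i (U i w) w ->
  jumps_at k w /\ sigma w = U i w.
Proof.
move=> i1 /andP[/andP[bU Ub] /andP[iN /eqP rk]].
have iN' : (1 <= i <= N w)%N by rewrite i1.
have Nk : Nt (U i w) w = k by rewrite (@trials_untilD1 _ _ _ _ i)// lexx add1n.
have k1 : (1 <= k)%N by rewrite -rk.
have sU : sigma w = U i w by apply: (@precursor_point _ _ N U b b1_lt1 b_noninc k); rewrite ?bU.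
by split=> //; split; rewrite /= sU.
Qed.

(** On this event the precursor is a point U i of rank k with
    b k.+1 < U i <= b k, and i is unique when there are no ties. Summing over i,
    each U i can be frozen. *)
Lemma integral_jumps k (F : set T) (h : R -> R) : time_free F ->
  measurable_fun setT h -> (forall t, 0 <= h t) ->
  (\int[P]_w (h (sigma w) * \1_(F `&` jumps_at k) w)%:E =
   \int[nu]_t ((h t * (b k.+1 < t <= b k)%R%:R)%:E *
     \sum_(0 <= i <oo) P (F `&` [set w | at_rank k i.+1 t w])))%E.
Proof.
move=> tF mh h0; have mF := time_free_measurable _ tF.
pose J t : R := h t * (b k.+1 < t <= b k)%R%:R.
have J0 t : 0 <= J t by rewrite mulr_ge0// ler0n.
have mJ : measurable_fun setT J.
  apply: measurable_funM => //.
  apply: (@measurableT_comp _ _ _ _ _ _ (fun c : bool => c%:R : R)) => //.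
  by apply: measurable_and; [exact: measurable_fun_ltr|exact: measurable_fun_ler].
pose f i w : \bar R := (J (U i.+1 w) * (\1_F w * (at_rank k i.+1 (U i.+1 w) w)%:R))%:E.
have f0 i w : (0 <= f i w)%E by rewrite lee_fin !mulr_ge0// ler0n.
have mf i : measurable_fun setT (f i).
  apply/measurable_EFinP; apply: measurable_funM; first exact: measurableT_comp.
  apply: measurable_funM; first exact: measurable_indic.
  apply: (@measurableT_comp _ _ _ _ _ _ (fun c : bool => c%:R : R)) => //.
  exact: (@measurable_at_rank _ _ id).
transitivity (\int[P]_w \sum_(0 <= i <oo) f i w)%E.
  apply: ge0_ae_eq_integral => //.
  - apply/measurable_EFinP; apply: measurable_funM.
      exact: (measurableT_comp mh measurable_sigma).
    by apply: measurable_indic; apply: measurableI => //; exact: measurable_jumps_at.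
  - exact: ge0_emeasurable_sum.
  - by move=> w _; rewrite lee_fin mulr_ge0.
  - by move=> w _; exact: nneseries_ge0.
  apply: filterS ae_generic => w [Uu _ _] _.
  have f_neq0 i : f i w != 0%E -> [/\ F w, jumps_at k w, (i < N w)%N & sigma w = U i.+1 w].
    rewrite /f /J !indicE -mulrA -!natrM !mulnb.
    have [win|] := boolP (b k.+1 < U i.+1 w <= b k); last by rewrite mulr0 eqxx.
    have [/set_mem Fw|] := boolP (w \in F); last by rewrite mulr0 eqxx.
    have [rk|] := boolP (at_rank _ _ _ _); last by rewrite mulr0 eqxx.
    move=> _; have [|jk sU] := @jumps_atP k i.+1 w isT; first by rewrite win.
    by case/andP: rk.
  have [[Fw jk]|nFj] := pselect ((F `&` jumps_at k) w); last first.
    rewrite indicE memNset// mulr0 eseries0// => i _ _.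
    by apply/eqP/negPn/negP => /f_neq0[Fw jk _ _]; exact: nFj.
  have [k1 [i /andP[i1 iN] [sU bU Nk]]] :=
    @precursor_epoch _ _ N U b b1_lt1 b_noninc k w Uu jk.1 jk.2.
  case: i i1 iN sU bU Nk => // i _ iN sU bU Nk.
  rewrite (@nneseries_pick _ _ i)//; last first.
    move=> j; apply: contraNeq => /f_neq0[_ _ jN sUj].
    have : U j.+1 w = U i.+1 w by rewrite -sU.
    have -> : U j.+1 w = nth 0 [seq U l w | l <- iota 1 (N w)] j.
      by rewrite (nth_map 0%N) ?size_iota// nth_iota// add1n.
    have -> : U i.+1 w = nth 0 [seq U l w | l <- iota 1 (N w)] i.
      by rewrite (nth_map 0%N) ?size_iota// nth_iota// add1n.
    by move/eqP; rewrite nth_uniq// size_map size_iota.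
  rewrite /f /J !indicE !mem_set// sU bU /at_rank iN mulr1 !mul1r.
  suff -> : (other_trials_until N U i.+1 (U i.+1 w) w).+1 == k by rewrite !mulr1.
  by apply/eqP; rewrite -Nk (@trials_untilD1 _ _ _ _ i.+1)// lexx add1n.
rewrite integral_nneseries//.
transitivity (\sum_(0 <= i <oo) \int[nu]_t ((J t)%:E * P (F `&` [set w | at_rank k i.+1 t w])))%E.
  by apply: eq_eseriesr => i _; exact: integral_at_rank.
rewrite -integral_nneseries//.
- by apply: eq_integral => t _; rewrite nneseriesZl// => i _; exact: measure_ge0.
- move=> i; apply: emeasurable_funM; first exact/measurable_EFinP.
  exact: measurable_at_rank_probability.
- by move=> i t _; rewrite mule_ge0// lee_fin.
Qed.

Definition one_success_after k : set T := [set w | nb_successes X k.+1 (N w) w = 1%N].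

Definition one_success_after_precursor : set T :=
  [set w | nb_successes X (Nsigma w).+1 (N w) w = 1%N].

Lemma time_free_setT : time_free setT.
Proof. by move=> i _; exact: measurableT. Qed.

Lemma time_free_one_success_after k : time_free (one_success_after k).
Proof.
move=> i i1; rewrite (_ : one_success_after k =
    [set w : sub (all_but_time i) | nb_successes X k.+1 (N w) w == 1%N]).
  apply: measurable_pred; apply: measurable_fun_eqn => //.
  apply: (@measurable_nb_successes _ (sub (all_but_time i)) N _ X (fun=> k)) => //.
    exact: measurable_number_sub.
  by move=> j j1; exact: measurable_outcome_sub.
by apply/seteqP; split=> w /= /eqP.
Qed.

Lemma measurable_one_success_after k : measurable (one_success_after k).
Proof. by apply: time_free_measurable; exact: time_free_one_success_after. Qed.

Lemma measurable_one_success_after_precursor :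
  measurable one_success_after_precursor.
Proof.
rewrite (_ : one_success_after_precursor =
    [set w | nb_successes X (Nsigma w).+1 (N w) w == 1%N]).
  apply: measurable_pred; apply: measurable_fun_eqn => //.
  apply: measurable_nb_successes => //.
  exact: measurable_precursor_index.
by apply/seteqP; split=> w /= /eqP.
Qed.

Lemma measurable_Nt_eq t k : measurable [set w | Nt t w = k].
Proof.
rewrite (_ : mkset _ = [set w | Nt t w == k]).
  apply: measurable_pred; apply: measurable_fun_eqn => //.
  exact: measurable_trials_until.
by apply/seteqP; split=> w /= /eqP.
Qed.

Lemma S1M t k : ((S1 P N U X t k)%:E * P [set w | Nt t w = k] =
  P (one_success_after k `&` [set w | Nt t w = k]))%E.
Proof.
apply: cond_probM; last exact: measurable_Nt_eq.
exact: measurable_one_success_after.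
Qed.

Lemma S1_ge0 t k : 0 <= S1 P N U X t k.
Proof. exact: cond_prob_ge0. Qed.

Lemma measurable_S1 k : measurable_fun setT (fun t => S1 P N U X t k).
Proof.
have mD : measurable [set z : R * T | Nt z.1 z.2 = k].
  rewrite (_ : mkset _ = [set z : R * T | Nt z.1 z.2 == k]).
    apply: measurable_pred; apply: measurable_fun_eqn => //.
    apply: (@measurable_trials_until _ (R * T)%type R (fun z => N z.2) _
      (fun i z => U i z.2) _ fst) => //.
    - exact: (measurableT_comp _ measurable_snd).
    - by move=> i _; exact: (measurableT_comp _ measurable_snd).
  by apply/seteqP; split=> w /= /eqP.
have mq (D : set (R * T)) : measurable D ->
    measurable_fun setT (fun t => fine (P [set w | D (t, w)])).
  move=> mD'; apply: (@measurableT_comp _ _ _ _ _ _ fine) => //.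
  exact: measurable_section_probability.
(* On nonnegative reals the power of exponent -1 is the inverse, at 0 too. *)
rewrite (_ : (fun t => _) = (fun t =>
  fine (P (one_success_after k `&` [set w | Nt t w = k])) *
  fine (P [set w | Nt t w = k]) `^ (-1))); last first.
  by apply/funext => t; rewrite powR_inv1// fine_ge0.
apply: measurable_funM; last first.
  apply: (@measurableT_comp _ _ _ _ _ _ (fun x : R => x `^ (-1))).
    exact: measurable_powR.
  exact: (mq _ mD).
apply: (mq (snd @^-1` one_success_after k `&` [set z : R * T | Nt z.1 z.2 = k])).
apply: measurableI => //; rewrite -[X in measurable X]setTI.
apply: measurable_snd => //; exact: measurable_one_success_after.
Qed.

(** Given that a point of rank k lies at t, the outlook is the same as given
    N_t = k: the two conditionings weigh the possible values of N alike. *)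
Lemma S1_at_rank t k : 0 < t ->
  ((S1 P N U X t k)%:E *
     \sum_(0 <= i <oo) P (setT `&` [set w | at_rank k i.+1 t w]) =
   \sum_(0 <= i <oo) P (one_success_after k `&` [set w | at_rank k i.+1 t w]))%E.
Proof.
move=> t0; have nu_fin : nu `]-oo, t] \is a fin_num by exact: fin_num_measure.
have nu0 : (0 < nu `]-oo, t])%E by rewrite U_law//; exact: uniform_prob_gt0.
have mulIe x y : (nu `]-oo, t] * x = nu `]-oo, t] * y -> x = y)%E.
  move=> xy; apply/eqP; rewrite eq_le.
  by rewrite -(lee_pmul2l nu_fin nu0 x) -(lee_pmul2l nu_fin nu0 y) xy lexx.
apply: mulIe.
rewrite muleCA !sum_at_rank; [|exact: time_free_one_success_after|exact: time_free_setT].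
by rewrite muleCA setTI S1M.
Qed.

(** The right-hand side is the integral of the constant 1 over the same event
    intersected with [one_success_after k]; both become integrals over the
    position t > b k.+1 >= 0 of the point, with equal integrands. *)
Lemma expectation_S1_jumps k :
  (\int[P]_w (S1 P N U X (sigma w) k * \1_(jumps_at k) w)%:E =
   P (one_success_after k `&` jumps_at k))%E.
Proof.
have mFj : measurable (one_success_after k `&` jumps_at k).
  apply: measurableI; last exact: measurable_jumps_at.
  exact: measurable_one_success_after.
transitivity (\int[P]_w (cst 1 (sigma w) * \1_(one_success_after k `&` jumps_at k) w)%:E)%E;
  last first.
  under eq_integral do rewrite mul1r.
  by rewrite integral_indic ?setIT.
have := @integral_jumps k setT (fun t => S1 P N U X t k) time_free_setT
  (measurable_S1 k) (S1_ge0 ^~ k).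
rewrite setTI => ->; rewrite integral_jumps//; last exact: time_free_one_success_after.
apply: eq_integral => t _; have [/andP[bt _]|] := boolP (b k.+1 < t <= b k); last first.
  by rewrite !mulr0 !mul0e.
by rewrite /cst !mulr1 mul1e S1_at_rank// (le_lt_trans _ bt)// b_ge0.
Qed.

Lemma cutoff_indexE k w : Nsigma w = k -> ~ jumps_at k w -> Nt (b k.+1) w = k.
Proof.
move=> Nk nj; have := precursor_ge N U b b1_lt1 b_noninc w; rewrite Nk le_eqVlt.
by move=> /predU1P[->//|bs]; exfalso; apply: nj.
Qed.

Lemma cutoff_not_jump k w : Nt (b k.+1) w = k -> Nsigma w = k /\ ~ jumps_at k w.
Proof.
move=> Nk; have sb := @precursor_cutoff _ _ N U b b1_lt1 b_noninc k w Nk.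
by rewrite sb; split=> // -[_]; rewrite sb ltxx.
Qed.

Lemma Nsigma_eqE k :
  [set w | Nsigma w = k] = [set w | Nt (b k.+1) w = k] `|` jumps_at k.
Proof.
apply/seteqP; split=> w /=; last first.
  by move=> [/cutoff_not_jump[]//|[]].
by move=> Nk; have [|/cutoff_indexE] := pselect (jumps_at k w); [right|left; auto].
Qed.

Lemma disjoint_cutoff_jumps k : [set w | Nt (b k.+1) w = k] `&` jumps_at k = set0.
Proof. by apply/seteqP; split=> // w [/= /cutoff_not_jump[]]. Qed.

(** The index k is reached either at the cutoff b k.+1, where sigma is constant
    and the claim is the product rule [S1M], or at an epoch. *)
Lemma expectation_S1_index k :
  (\int[P]_w (S1 P N U X (sigma w) k * \1_[set w | Nsigma w = k] w)%:E =
   P (one_success_after k `&` [set w | Nsigma w = k]))%E.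
Proof.
have mS : measurable_fun setT (fun w => S1 P N U X (sigma w) k).
  exact: (measurableT_comp (measurable_S1 k) measurable_sigma).
have mF := measurable_one_success_after k.
have mC := measurable_Nt_eq (b k.+1) k; have mJ := measurable_jumps_at k.
have disj := disjoint_cutoff_jumps k.
rewrite Nsigma_eqE setIUr.
transitivity (P (one_success_after k `&` [set w | Nt (b k.+1) w = k]) +
    P (one_success_after k `&` jumps_at k))%E; last first.
  rewrite measureU//; [exact: measurableI|exact: measurableI|].
  by rewrite setIACA disj setI0.
rewrite -expectation_S1_jumps -S1M.
transitivity (\int[P]_w ((S1 P N U X (b k.+1) k)%:E * (\1_[set w | Nt (b k.+1) w = k] w)%:E
   + (S1 P N U X (sigma w) k * \1_(jumps_at k) w)%:E))%E.
  apply: eq_integral => w _; rewrite -EFinM -EFinD; congr (_%:E).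
  rewrite !indicE in_setU; have [/set_mem /= Nk|_] := boolP (w \in [set w | Nt _ w = k]).
    have [_ nj] := cutoff_not_jump _ _ Nk.
    by rewrite (precursor_cutoff N U b b1_lt1 b_noninc k)// memNset// mulr0 addr0.
  by rewrite mulr0 add0r.
rewrite ge0_integralD//.
- by rewrite ge0_integralZl// ?lee_fin ?S1_ge0// ?integral_indic ?setIT//;
    exact/measurable_EFinP/measurable_indic.
- by move=> w _; rewrite mule_ge0// lee_fin ?S1_ge0.
- by apply: emeasurable_funM => //; exact/measurable_EFinP/measurable_indic.
- by move=> w _; rewrite lee_fin mulr_ge0// S1_ge0.
- by apply/measurable_EFinP; apply: measurable_funM => //; exact: measurable_indic.
Qed.

Lemma probability_partition (g : T -> nat) (A : set T) : measurable A ->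
  (forall k, measurable [set w | g w = k]) ->
  (P A = \sum_(0 <= k <oo) P (A `&` [set w | g w = k]))%E.
Proof.
move=> mA mg.
transitivity (P (\bigcup_k (A `&` [set w | g w = k]))).
  congr (P _); apply/seteqP; split=> [w Aw|w [k _ []]//].
  by exists (g w).
rewrite measure_bigcup//.
- by apply: eq_eseriesl => k; rewrite in_setT.
- by move=> k _; exact: measurableI.
- by apply/trivIsetP => i j _ _ ij; apply/seteqP; split=> // w [[_ /= gi] [_ /= gj]];
    rewrite -gi -gj eqxx in ij.
Qed.

Lemma one_success_after_precursorI k :
  one_success_after_precursor `&` [set w | Nsigma w = k] =
  one_success_after k `&` [set w | Nsigma w = k].
Proof.
by apply/seteqP; split=> w []; rewrite /one_success_after_precursor /one_success_after /= => + Nk;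
  rewrite Nk.
Qed.

Lemma expectation_S1 :
  ('E_P[fun w => S1 P N U X (sigma w) (Nsigma w)] = P one_success_after_precursor)%E.
Proof.
rewrite (probability_partition Nsigma)//; last 2 first.
- exact: measurable_one_success_after_precursor.
- exact: measurable_Nsigma_eq.
rewrite unlock.
transitivity (\int[P]_w
    \sum_(0 <= k <oo) (S1 P N U X (sigma w) k * \1_[set w | Nsigma w = k] w)%:E)%E.
  apply: eq_integral => w _; rewrite (@nneseries_pick _ _ (Nsigma w)).
  - by rewrite indicE mem_set// mulr1.
  - by move=> k; rewrite lee_fin mulr_ge0// S1_ge0.
  - by move=> k kN; rewrite indicE memNset ?mulr0// => /= Nk; rewrite -Nk eqxx in kN.
rewrite integral_nneseries//.
- by apply: eq_eseriesr => k _; rewrite expectation_S1_index one_success_after_precursorI.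
- move=> k; apply/measurable_EFinP; apply: measurable_funM.
    exact: (measurableT_comp (measurable_S1 k) measurable_sigma).
  by apply: measurable_indic; exact: measurable_Nsigma_eq.
- by move=> k w _; rewrite lee_fin mulr_ge0// S1_ge0.
Qed.

Lemma probability_wins : P (wins N U X B) = P one_success_after_precursor.
Proof.
apply: ae_eq_probability.
- exact: measurable_wins.
- exact: measurable_one_success_after_precursor.
apply: filterS ae_generic => w [Uu Ub U1]; apply: winsE => k kN.
exact: cutoff_epochE.
Qed.

(** Once N = n and N_sigma = k are fixed, what remains of the event concerns the
    outcomes k + 1, ..., n, which are independent of N and of the times. For
    k >= n and for n = 0 there is no trial left to be a success. *)
Lemma probability_one_success_after_precursor :
  (P one_success_after_precursor = \sum_(1 <= n <oo) (P [set w | N w = n] *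
     (\sum_(0 <= k < n) (cond_prob P [set w | Nsigma w = k] [set w | N w = n]
        * s1 P X k.+1 n)%R%:E)))%E.
Proof.
have mW := measurable_one_success_after_precursor.
have mN n : measurable [set w | N w = n].
  rewrite (_ : mkset _ = [set w | N w == n]).
    by apply: measurable_pred; exact: measurable_fun_eqn.
  by apply/seteqP; split=> w /= /eqP.
rewrite (probability_partition N)// nneseries_recl//.
rewrite (_ : _ `&` _ = set0); last first.
  apply/seteqP; split=> // w [+ N0].
  rewrite /one_success_after_precursor /= nb_successes1P N0 => -[k /andP[/andP[+ k0] _] _].
  by rewrite ltnNge (leq_trans k0).
rewrite measure0 add0e; apply: eq_eseriesr => n _.
rewrite (probability_partition Nsigma); [|exact: measurableI|exact: measurable_Nsigma_eq].
rewrite (@nneseries_trunc _ _ n)//; last first.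
  move=> k nk; rewrite (_ : _ `&` _ = set0)//.
  apply/seteqP; split=> // w [[+ /= Nn] /= Nk].
  rewrite /one_success_after_precursor /= nb_successes1P Nk Nn => -[j /andP[/andP[kj jn] _] _].
  by move: (leq_trans kj jn); rewrite ltnNge nk.
rewrite ge0_sume_distrr; last first.
  by move=> k _; rewrite lee_fin mulr_ge0 ?cond_prob_ge0// fine_ge0.
apply: eq_bigr => k _.
have mS : measurable [set w | nb_successes X k.+1 n w = 1%N].
  rewrite (_ : mkset _ = [set w | nb_successes X k.+1 n w == 1%N]).
    apply: measurable_pred; apply: measurable_fun_eqn => //.
    by apply: (@measurable_nb_successes _ _ (fun=> n) _ X (fun=> k)).
  by apply/seteqP; split=> w /= /eqP.
rewrite EFinM muleA [(P [set w | N w = n] * _)%E]muleC.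
rewrite cond_probM//; last exact: measurable_Nsigma_eq.
rewrite /s1 fineK ?fin_num_measure//.
rewrite -(@indep_sub times_and_number outcomes).
- congr (P _); apply/seteqP; split=> w /=.
    by rewrite /one_success_after_precursor => -[[/= + Nn] Nk]; rewrite Nn Nk.
  by move=> -[[Nk Nn]]; rewrite /one_success_after_precursor /= Nn Nk.
- by apply/seteqP; split=> // -[[i|j]|] [].
- apply: measurableI.
    rewrite (_ : mkset _ = [set w : sub times_and_number | Nsigma w == k]).
      apply: measurable_pred; apply: measurable_fun_eqn => //.
      apply: (@measurable_precursor_index _ (sub times_and_number)) => //.
        exact: measurable_number_sub.
      by move=> i i1; exact: measurable_time_sub.
    by apply/seteqP; split=> w /= /eqP.
  rewrite (_ : mkset _ = [set w : sub times_and_number | N w == n]).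
    apply: measurable_pred; apply: measurable_fun_eqn => //.
    exact: measurable_number_sub.
  by apply/seteqP; split=> w /= /eqP.
- rewrite (_ : mkset _ = [set w : sub outcomes | nb_successes X k.+1 n w == 1%N]).
    apply: measurable_pred; apply: measurable_fun_eqn => //.
    apply: (@measurable_nb_successes _ (sub outcomes) (fun=> n) _ X (fun=> k)) => //.
    by move=> j j1; exact: measurable_outcome_sub.
  by apply/seteqP; split=> w /= /eqP.
Qed.

End model.

Theorem mainTheorem4 (R : realType) (d : measure_display)
    (T : measurableType d) (P : probability T R)
    (pi p b : nat -> R)
    (N : {RV P >-> nat}) (U : nat -> {RV P >-> R}) (X : nat -> {RV P >-> bool})
    (pi_ge0 : forall n, 0 <= pi n)
    (pi_sum1 : (\sum_(0 <= n <oo) (pi n)%:E = 1)%E)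
    (p1 : p 1%N = 1)
    (p_gt1 : forall k, (1 < k)%N -> 0 < p k < 1)
    (N_law : forall n, P [set w | N w = n] = (pi n)%:E)
    (U_law : forall i, (1 <= i)%N -> forall A : set R, measurable A ->
       distribution P (U i) A = uniform_prob (@ltr01 R) A)
    (X_law : forall k, (1 <= k)%N -> P [set w | X k w] = (p k)%:E)
    (indep : mutually_independent P (generated_systems N U X))
    (b1_lt1 : b 1%N < 1)
    (b_noninc : forall k, (1 <= k)%N -> b k.+1 <= b k)
    (b_ge0 : forall k, (1 <= k)%N -> 0 <= b k) :
  let B := cutoff_set b in
  let sigma := precursor N U B in
  let Nsigma := fun w => trials_until N U (sigma w) w in
  (P (wins N U X B) = 'E_P[fun w => S1 P N U X (sigma w) (Nsigma w)])%E /\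
  ('E_P[fun w => S1 P N U X (sigma w) (Nsigma w)] =
   \sum_(1 <= n <oo) ((pi n)%:E *
     (\sum_(0 <= k < n)
        (cond_prob P [set w | Nsigma w = k] [set w | N w = n]
         * s1 P X k.+1 n)%R%:E)))%E.
Proof.
move=> B sigma Nsigma; rewrite /Nsigma /sigma /B.
rewrite expectation_S1// probability_wins//; split=> //.
rewrite probability_one_success_after_precursor//.
by apply: eq_eseriesr => n _; rewrite N_law.
Qed.
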